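(* Let $d\ge 3$. Suppose that $m(P:x,y)\ge 3$ for every $d$-dimensional Dantzig figure $(P,x,y)$. Then every fundamental deformation of every $d$-dimensional Dantzig figure is good; that is, $E(d)=D(d)$ (the ''Strong Dantzig conjecture'' in dimension $d$).
   Context: Polytopes are bounded convex polytopes in $\mathbb{R}^d$. A $d$-dimensional Dantzig figure is a triple $(P,x,y)$ where $P$ is a simple $d$-dimensional convex polytope with exactly $2d$ facets and $x,y$ are vertices of $P$ such that $d$ of the facets contain $x$ and the other $d$ facets contain $y$. Paths are edge-following paths in the vertex-edge graph of the polytope; the length of a path is its number of edges, and a geodesic between $x$ and $y$ is a path of minimum length joining them. $m(P:x,y)$ is the maximum number of geodesics between $x$ and $y$ in the graph of $P$ such that any two of them have only the vertices $x,y$ in common. Fundamental deformation (FD) of a simple polytope $P$ with facets $F_1,\dots,F_n$ lying in hyperplanes $\pi_1,\dots,\pi_n$: a family of polytopes $P(t)$, $0\le t\le 1$, $P(0)=P$, obtained by continuously moving one hyperplane $\pi_i$. That is, the facets of $P(t)$ lie in the fixed hyperplanes $\pi_j$ ($j\ne i$) and a hyperplane $\pi_i(t)$ depending continuously on $t$ with $\pi_i(0)=\pi_i$, such that: (1) $P(t)$ is simple except for exactly one value $t=t_0<1$; (2) exactly one vertex $v$ of $P$ that is an intersection of some of the $\pi_j$ with $j\neq i$ is passed through by the moving hyperplane: $\pi_i(t_0)$ passes through $v$, and $v\notin P(t)$ for $t>t_0$; (3) $P(t)\subset P(s)$ for $t>s$. One also calls $P(1)$ a fundamental deformation of $P$.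 Exactly one edge disappears in the process, namely the edge joining $v$ to a vertex $w$ on the moving facet, which shrinks to the point $v$ at $t=t_0$. It is called the vanishing edge. A fundamental deformation of a Dantzig figure $(P,x,y)$ is a fundamental deformation of $P$ whose vanishing edge has neither $x$ nor $y$ as an endpoint; the deformed figure has as distinguished vertices the vertices lying on the facets corresponding to those through $x$, respectively $y$. A fundamental deformation of a Dantzig figure $(P,x,y)$ is good if there is a geodesic between $x$ and $y$ in $P$ that either traverses the vanishing edge or does not touch it at all (contains neither of its endpoints). $D(d)$ is the directed graph whose vertices are the combinatorial types of $d$-dimensional Dantzig figures and whose arrows correspond to fundamental deformations of Dantzig figures. $E(d)$ is the subgraph with the same vertex set whose arrows are those corresponding to good fundamental deformations. *)

(* Defs.v *)
(* MathComp / MathComp-Analysis; the real numbers are an arbitrary R : realType. *)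
From HB Require Import structures.
From mathcomp Require Export all_boot all_order all_algebra.
From mathcomp Require Export all_classical all_reals all_analysis.
Set Implicit Arguments.
Unset Strict Implicit.
Unset Printing Implicit Defensive.
Import Order.TTheory GRing.Theory Num.Theory numFieldNormedType.Exports.
Local Open Scope classical_set_scope.
Local Open Scope ring_scope.

Section Polytopes.
Variables (R : realType) (d : nat).
Local Notation V := 'rV[R]_d.

Definition dotp (a z : V) : R := \sum_(k < d) a 0 k * z 0 k.

Definition hyperplane (a : V) (b : R) : set V := [set z | dotp a z = b].

Definition halfspace (a : V) (b : R) : set V := [set z | dotp a z <= b].

Definition polytope (P : set V) : Prop :=
  bounded_set P /\
  exists (n : nat) (a : 'I_n -> V) (b : 'I_n -> R),
    P = \bigcap_(j in [set: 'I_n]) halfspace (a j) (b j).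

Definition affinely_independent (k : nat) (p : 'I_k.+1 -> V) : Prop :=
  row_free (\matrix_(i < k) (p (lift ord0 i) - p ord0)).

(* The affine hull of S has dimension k; no k satisfies this when S is empty. *)
Definition has_dim (S : set V) (k : nat) : Prop :=
  (exists p : 'I_k.+1 -> V, (forall i, S (p i)) /\ affinely_independent p) /\
  ~ (exists p : 'I_k.+2 -> V, (forall i, S (p i)) /\ affinely_independent p).

(* With a = 0 one gets the improper faces P (b = 0) and set0 (b > 0). *)
Definition face (P F : set V) : Prop :=
  exists (a : V) (b : R), P `<=` halfspace a b /\ F = P `&` hyperplane a b.

Definition vertex (P : set V) (v : V) : Prop := face P [set v].

Definition edge (P E : set V) : Prop := face P E /\ has_dim E 1.

Definition facet (P F : set V) : Prop := face P F /\ has_dim F d.-1.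

Definition facets_at (P : set V) (z : V) : set (set V) :=
  [set F | facet P F /\ F z].

Definition edge_between (P E : set V) (u w : V) : Prop :=
  [/\ edge P E, vertex P u, vertex P w, u != w & E u /\ E w].

Definition adjacent (P : set V) : rel V :=
  fun u w => `[< exists E, edge_between P E u w >].

Definition d_polytope (P : set V) : Prop := polytope P /\ has_dim P d.

Definition simple_polytope (P : set V) : Prop :=
  d_polytope P /\ forall v, vertex P v -> (facets_at P v #= `I_d)%card.

(* A path is the sequence of the vertices it visits, both ends included;
   its number of edges is therefore (size p).-1. *)
Definition is_path (P : set V) (x y : V) (p : seq V) : Prop :=
  if p is u :: s then [/\ u = x, path (adjacent P) u s & last u s = y]
  else False.

Definition geodesic (P : set V) (x y : V) (p : seq V) : Prop :=
  is_path P x y p /\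
  forall q, is_path P x y q -> ((size p).-1 <= (size q).-1)%N.

Definition disjoint_geodesics (P : set V) (x y : V) (G : seq (seq V)) : Prop :=
  [/\ uniq G,
      forall p, p \in G -> geodesic P x y p
    & forall p q, p \in G -> q \in G -> p != q ->
      forall z, z \in p -> z \in q -> z = x \/ z = y].

(* m(P : x, y). The maximum exists, the graph of a polytope being finite, so
   that the default value 0 of xget is irrelevant. *)
Definition max_disjoint_geodesics (P : set V) (x y : V) : nat :=
  xget 0%N [set k | (exists2 G, disjoint_geodesics P x y G & size G = k) /\
                    forall G, disjoint_geodesics P x y G -> (size G <= k)%N].

Definition is_dantzig (P : set V) (x y : V) : Prop :=
  [/\ simple_polytope P,
      ([set F | facet P F] #= `I_(2 * d))%card,
      vertex P x /\ vertex P y,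
      (facets_at P x #= `I_d)%card
    & facets_at P y = [set F | facet P F] `\` facets_at P x].

Record dantzig_figure := DantzigFigure {
  body : set V;
  src : V;
  tgt : V;
  dantzigP : is_dantzig body src tgt }.

(* Isomorphism of face lattices respecting the two distinguished vertices. *)
Definition same_type (D D' : dantzig_figure) : Prop :=
  exists f : set V -> set V,
    [/\ set_bij [set F | face (body D) F] [set F | face (body D') F] f,
        forall F G, face (body D) F -> face (body D) G ->
          (F `<=` G <-> f F `<=` f G),
        f [set src D] = [set src D']
      & f [set tgt D] = [set tgt D']].

Definition comb_type (D : dantzig_figure) : set dantzig_figure :=
  [set D' | same_type D D'].

(* The halfspace j at time t is halfspace (normal j t) (offset j t); only the
   one of index moving is going to depend on t. *)
Record motion := Motion {
  nfacets : nat;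
  normal : 'I_nfacets -> R -> V;
  offset : 'I_nfacets -> R -> R;
  moving : 'I_nfacets }.

Definition plane (M : motion) (j : 'I_(nfacets M)) (t : R) : set V :=
  hyperplane (normal j t) (offset j t).

Definition body_at (M : motion) (t : R) : set V :=
  \bigcap_(j in [set: 'I_(nfacets M)]) halfspace (normal j t) (offset j t).

(* The part of P(t) lying in all the hyperplanes pi_j(t) for which pi_j(0)
   contains E; it is E itself when t = 0 and E is a nonempty face of P(0). *)
Definition face_at (M : motion) (E : set V) (t : R) : set V :=
  [set z | body_at M t z /\ forall j, E `<=` @plane M j 0 -> @plane M j t z].

(* v is an intersection of some of the fixed hyperplanes *)
Definition fixed_point (M : motion) (v : V) : Prop :=
  exists2 J : {set 'I_(nfacets M)}, moving M \notin J
    & \bigcap_(j in [set` J]) @plane M j 0 = [set v].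

Definition disappears (M : motion) (P E : set V) : Prop :=
  edge P E /\ ~ edge (body_at M 1) (face_at M E 1).

(* M is a fundamental deformation of P with critical time t0 and with vanishing
   edge joining v to w, where w lies on the moving facet. *)
Record fundamental_deformation (P : set V) (M : motion) (t0 : R) (v w : V)
    : Prop := FundamentalDeformation {
  fd_simple : simple_polytope P;
  fd_start : body_at M 0 = P;
  fd_facets : set_bij [set: 'I_(nfacets M)] [set F | facet P F]
                (fun j => P `&` @plane M j 0);
  fd_normal : forall j t, 0 <= t <= 1 -> @normal M j t != 0;
  fd_fixed : forall j, j != moving M -> forall t, 0 <= t <= 1 ->
    @normal M j t = @normal M j 0 /\ @offset M j t = @offset M j 0;
  fd_normal_cont : {within `[0, 1], continuous (@normal M (moving M))};
  fd_offset_cont : {within `[0, 1], continuous (@offset M (moving M))};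
  fd_polytope : forall t, 0 <= t <= 1 -> d_polytope (body_at M t);
  fd_time : 0 <= t0 < 1;
  fd_nonsimple : forall t, 0 <= t <= 1 ->
    (simple_polytope (body_at M t) <-> t <> t0);
  fd_vertex : vertex P v /\ fixed_point M v;
  fd_hit : plane (moving M) t0 v;
  fd_gone : forall t, t0 < t <= 1 -> ~ body_at M t v;
  fd_only : forall u t, vertex P u -> fixed_point M u -> 0 <= t <= 1 ->
    plane (moving M) t u -> u = v;
  fd_shrinks : forall s t, 0 <= s -> s < t -> t <= 1 ->
    body_at M t `<=` body_at M s;
  fd_on_moving : plane (moving M) 0 w;
  fd_vanishing : exists E, [/\ edge_between P E v w,
    face_at M E t0 = [set v],
    disappears M P E & forall E', disappears M P E' -> E' = E] }.

Definition dantzig_deformation (D : dantzig_figure) (M : motion) (t0 : R)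
    (v w : V) : Prop :=
  [/\ fundamental_deformation (body D) M t0 v w,
      v != src D /\ v != tgt D
    & w != src D /\ w != tgt D].

Definition deformed_figure (D : dantzig_figure) (M : motion)
    (D' : dantzig_figure) : Prop :=
  [/\ body D' = body_at M 1,
      forall j, @plane M j 0 (src D) -> @plane M j 1 (src D')
    & forall j, @plane M j 0 (tgt D) -> @plane M j 1 (tgt D')].

Definition traverses (p : seq V) (v w : V) : Prop :=
  infix [:: v; w] p || infix [:: w; v] p.

Definition good (D : dantzig_figure) (v w : V) : Prop :=
  exists2 p, geodesic (body D) (src D) (tgt D) p &
    traverses p v w \/ (v \notin p /\ w \notin p).

Record digraph (T : Type) := Digraph {
  vertices : set T;
  arrows : set (T * T) }.

Definition D_graph : digraph (set dantzig_figure) := {|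
  vertices := range comb_type;
  arrows := [set a | exists D M t0 v w D',
    [/\ dantzig_deformation D M t0 v w, deformed_figure D M D'
      & a = (comb_type D, comb_type D')]] |}.

Definition E_graph : digraph (set dantzig_figure) := {|
  vertices := range comb_type;
  arrows := [set a | exists D M t0 v w D',
    [/\ dantzig_deformation D M t0 v w, good D v w, deformed_figure D M D'
      & a = (comb_type D, comb_type D')]] |}.

End Polytopes.

(* Main.v *)
(* A vertex other than the two distinguished ones lies on at most one of a
   family of internally disjoint geodesics, so of any three geodesics in such a
   family at least one avoids both ends of the vanishing edge. *)
Require Import Defs.
From mathcomp Require Import all_boot all_order all_algebra.
From mathcomp Require Import all_classical all_reals all_analysis.

Set Implicit Arguments.
Unset Strict Implicit.
Unset Printing Implicit Defensive.
Local Open Scope classical_set_scope.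

Lemma count_le1 (T : eqType) (a : pred T) (s : seq T) : uniq s ->
  {in s &, forall x y, a x -> a y -> x = y} -> count a s <= 1.
Proof.
move=> us inj; rewrite -size_filter.
have := filter_uniq a us; have := mem_filter a ^~ s.
(* Two leading entries [x], [y] of the filtered list would be equal by hypothesis, against its being
   duplicate-free. *)
case: [seq x <- s | a x] => [|x [|y r]] //= memE; have := (memE x, memE y).
rewrite !inE !eqxx orbT => -[/esym/andP[ax xs] /esym/andP[ay ys]].
by rewrite (inj x y xs ys ax ay) eqxx.
Qed.

Section Geodesics.
Variables (R : realType) (d : nat).
Local Notation V := 'rV[R]_d.

(** Positivity excludes the default 0 of [xget], so the value satisfies the defining property of the
    maximum. *)
Lemma max_disjoint_geodesics_attained (P : set V) (x y : V) :
  0 < max_disjoint_geodesics P x y ->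
  exists2 G, disjoint_geodesics P x y G & size G = max_disjoint_geodesics P x y.
Proof. by rewrite /max_disjoint_geodesics; case: xgetP => // k _ []. Qed.

Lemma count_through_le1 (P : set V) (x y z : V) (G : seq (seq V)) :
  disjoint_geodesics P x y G -> z != x -> z != y ->
  count (fun p => z \in p) G <= 1.
Proof.
move=> [uG _ disjG] /eqP zx /eqP zy; apply: count_le1 => // p q pG qG zp zq.
by apply/eqP/negPn/negP => /(disjG _ _ pG qG)/(_ z zp zq)[].
Qed.

Lemma geodesic_avoiding2 (P : set V) (x y v w : V) :
  3 <= max_disjoint_geodesics P x y ->
  v != x -> v != y -> w != x -> w != y ->
  exists p, [/\ geodesic P x y p, v \notin p & w \notin p].
Proof.
move=> m3 vx vy wx wy.
have [G disjG szG] := max_disjoint_geodesics_attained (leq_trans (ltn0Sn _) m3).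
have : ~~ all (predU (fun p => v \in p) (fun p => w \in p)) G.
  apply/negP; rewrite all_count => /eqP countG.
  have := leq_add (count_through_le1 disjG vx vy) (count_through_le1 disjG wx wy).
  (* Inclusion-exclusion: if every path of [G] met [v] or [w], then [size G] plus the number of
     paths meeting both would be at most 2. *)
  by rewrite -count_predUI countG szG leqNgt (leq_trans m3 (leq_addr _ _)).
case/allPn => p pG /norP[vp wp]; exists p; split=> //.
by case: disjG => _ geoG _; apply: geoG.
Qed.

End Geodesics.

Theorem theorem4p4 (R : realType) (d : nat) (hd : (3 <= d)%N) :
  (forall D : dantzig_figure R d,
     (3 <= max_disjoint_geodesics (body D) (src D) (tgt D))%N) ->
  (forall (D : dantzig_figure R d) (M : motion R d) (t0 : R) (v w : 'rV[R]_d),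
     dantzig_deformation D M t0 v w -> good D v w) /\
  E_graph R d = D_graph R d.
Proof.
move=> m3.
have all_good (D : dantzig_figure R d) M t0 v w :
    dantzig_deformation D M t0 v w -> good D v w.
  move=> [_ [vx vy] [wx wy]].
  have [p [geop vp wp]] := geodesic_avoiding2 (m3 D) vx vy wx wy.
  by exists p; last right.
(* Both graphs have the same vertex set by definition, so only the arrow sets are compared; the
   inclusion of [D_graph] in [E_graph] is where goodness enters. *)
split=> //; congr Digraph; apply/seteqP.
split=> a [D [M [t0 [v [w [D' H]]]]]]; exists D, M, t0, v, w, D'.
  by case: H.
by case: H => deform defD' ->; split=> //; apply: all_good deform.
Qed.
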